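(* Let $x\in(0,\infty)$, $\pi\in[0,1]$ and $\hat{x} \in (x,\infty)$. Then the stopping set $D$ satisfies $$(x,\pi) \in D \Rightarrow (\hat{x}, \pi) \in D.$$
   Context: Setting. Fix constants $I>0$, $\sigma>0$, $r>0$ and reals $\mu_0<\mu_1$ with $r>\max\{\mu_0,\mu_1\}$. Let $\Omega=[0,1]\times C(\mathbb{R}_+)$ (with $C(\mathbb{R}_+)$ the continuous functions $\mathbb{R}_+\to\mathbb{R}$), with its Borel $\sigma$-algebra and $\mathbb{P}=\mathbb{U}\otimes\mathbb{W}$, where $\mathbb{U}$ is the uniform distribution on $[0,1]$ and $\mathbb{W}$ is Wiener measure. For $\pi\in[0,1]$ let $\theta^\pi(u,w)=\mathbb{I}_{[0,\pi]}(u)$ (so $\mathbb{P}(\theta^\pi=1)=\pi$) and let $W_t(u,w)=w(t)$, a standard Brownian motion. For $(x,\pi)\in(0,\infty)\times[0,1]$ let $$X^{x,\pi}_t = x\exp\left((\mu_{\theta^\pi}-\tfrac12\sigma^2)t+\sigma W_t\right),\quad t\ge0.$$ Let $\mathcal{F}^{X^{x,\pi}}$ be the augmented filtration generated by $X^{x,\pi}$ and $\mathcal{T}^{x,\pi}$ the set of $\mathcal{F}^{X^{x,\pi}}$-stopping times (the value $\infty$ is allowed). The belief process is $\Pi^\pi_t=\mathbb{P}(\theta^\pi=1\mid\mathcal{F}^{X^{x,\pi}}_t)$, $\Pi_0^\pi=\pi$ (it does not depend on $x$; its continuous version is used). The payoff function $g:(0,\infty)\times[0,1]\to\mathbb{R}$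 is $$g(x,\pi)=x\left(\frac{1-\pi}{r-\mu_0}+\frac{\pi}{r-\mu_1}\right)-I.$$ The value function is $$V(x,\pi)=\sup_{\tau\in\mathcal{T}^{x,\pi}}\mathbb{E}\left[e^{-r\tau}\left(\int_0^\infty e^{-rs}X^{x,\pi}_{\tau+s}\,ds-I\right)\right],$$ which equals both $\sup_{\tau\in\mathcal{T}^{x,\pi}}\mathbb{E}\left[e^{-r\tau}\left(\frac{X^{x,\pi}_\tau}{r-\mu_{\theta^\pi}}-I\right)\right]$ and $\sup_{\tau\in\mathcal{T}^{x,\pi}}\mathbb{E}[e^{-r\tau}g(X^{x,\pi}_\tau,\Pi^\pi_\tau)]$. Payoffs are $0$ on $\{\tau=\infty\}$ (no investment). The stopping set is $D=\{(x,\pi)\in(0,\infty)\times[0,1]: V(x,\pi)=g(x,\pi)\}$. *)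

(* Defs.v *)
From HB Require Import structures.
From mathcomp Require Import all_boot all_order all_algebra.
From mathcomp Require Import all_classical all_reals all_analysis.
From mathcomp Require Import measurable_realfun.

Set Implicit Arguments.
Unset Strict Implicit.
Unset Printing Implicit Defensive.

Import Order.TTheory GRing.Theory Num.Theory.
Import numFieldNormedType.Exports.

Local Open Scope classical_set_scope.
Local Open Scope ring_scope.

Definition borel (T : ptopologicalType) : Type := g_sigma_algebraType (@open T).

HB.instance Definition _ (T : ptopologicalType) := Measurable.on (borel T).

Section UnitInterval.
Variable R : realType.

Definition unit_interval : Type := set_type (`[0, 1]%classic : set R).

Lemma unit_interval0 : (0 : R) \in (`[0, 1]%classic : set R).
Proof. by rewrite inE /= in_itv /= lexx ler01. Qed.

HB.instance Definition _ := Topological.on unit_interval.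
HB.instance Definition _ := isPointed.Build unit_interval
  (exist _ 0 unit_interval0).

(* The identity on [0, 1]; other reals are sent to 0. *)
Definition to_unit (t : measurableTypeR R) : borel unit_interval :=
  insubd (point : unit_interval) t.

Lemma measurable_to_unit : measurable_fun setT to_unit.
Proof.
apply: (@measurability _ _ _ _ setT to_unit (@open unit_interval)) => //.
move=> _ [_ [V oV <-] <-]; rewrite setTI.
set B := _ @^-1` _.
have -> : B = (`[0, 1]%classic `&` V) `|` (~` `[0, 1]%classic `&` [set _ | V 0]).
  rewrite /B; apply/seteqP; split=> t /=.
    rewrite /to_unit /insubd; case: insubP => [u + ut|].
      by rewrite inE => t01 Vu; left; split=> //; rewrite -ut; exact: Vu.
    by rewrite notin_setE => nt V0; right.
  rewrite /to_unit /insubd; case: insubP => [u + ut|].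
    by rewrite inE => t01 [[_]|[/(_ t01)//]]; rewrite -ut.
  by rewrite notin_setE => nt [[/nt]|[]].
apply: measurableU; first by apply: measurableI => //; exact: open_measurable.
apply: measurableI; first exact: measurableC.
have [V0|V0] := pselect (V 0).
  by rewrite (_ : [set _ | _] = setT)//; apply/seteqP; split.
by rewrite (_ : [set _ | _] = set0)//; apply/seteqP; split.
Qed.

HB.instance Definition _ := isMeasurableFun.Build _ _ _ _ to_unit
  measurable_to_unit.

Definition uniform_unit : probability (borel unit_interval) R :=
  distribution (uniform_prob (@ltr01 R)) to_unit.

End UnitInterval.

Section PathSpace.
Variable R : realType.

Definition Rplus : Type := set_type (`[0, +oo[%classic : set R).

Lemma Rplus0 : (0 : R) \in (`[0, +oo[%classic : set R).
Proof. by rewrite inE /= in_itv /= lexx. Qed.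

HB.instance Definition _ := Topological.on Rplus.

(* The identity on R_+; negative reals, which never matter as times below, are
   sent to 0. *)
Definition to_Rplus (t : R) : Rplus := insubd (exist _ 0 Rplus0 : Rplus) t.

Definition CRplus : Type := continuousType Rplus R.

HB.instance Definition _ := Choice.on CRplus.
HB.instance Definition _ := isPointed.Build CRplus
  (cst 0 : continuousType Rplus R).

(* Uniform convergence on compact sets. *)
HB.instance Definition _ := Topological.copy CRplus
  (@initial_topology CRplus {compact-open, Rplus -> R}
     (fun w : continuousType Rplus R => w : Rplus -> R)).

Definition path_at (w : CRplus) (t : R) : R :=
  (w : continuousType Rplus R) (to_Rplus t).

(* [normal_prob m s] is parametrized by the standard deviation [s]. *)
Definition wiener_measure (W : probability (borel CRplus) R) : Prop :=
  W [set w | path_at w 0 = 0] = 1%E /\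
  forall (n : nat) (t : nat -> R) (B : nat -> set R),
    0 <= t 0%N -> (forall i, (i < n)%N -> t i < t i.+1) ->
    (forall i, (i < n)%N -> measurable (B i)) ->
    W (\bigcap_(i < n) [set w | B i (path_at w (t i.+1) - path_at w (t i))]) =
    (\prod_(i < n) normal_prob 0 (Num.sqrt (t i.+1 - t i)) (B i))%E.

End PathSpace.

Section Model.
Variables (R : realType) (W : probability (borel (CRplus R)) R).
Variables (I r sigma mu0 mu1 : R).

Definition Omega : Type := (borel (unit_interval R) * borel (CRplus R))%type.

HB.instance Definition _ := Measurable.on Omega.

Definition Pr : probability Omega R := (uniform_unit R \x W)%E.

Definition theta (p : R) (o : Omega) : bool :=
  \val (o.1 : unit_interval R) <= p.

Definition drift (p : R) (o : Omega) : R := if theta p o then mu1 else mu0.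

Definition BM (t : R) (o : Omega) : R := path_at o.2 t.

Definition X (x p t : R) (o : Omega) : R :=
  x * expR ((drift p o - sigma ^+ 2 / 2) * t + sigma * BM t o).

(* The smallest sigma-algebra containing all P-negligible sets (not only the
   Borel ones) that makes [X x p s] measurable for all [0 <= s <= t]. *)
Definition filtration (x p t : R) : set (set Omega) :=
  <<s [set A | exists s, 0 <= s <= t /\
         exists2 B, measurable B & A = X x p s @^-1` B]
      `|` Pr.-negligible >>.

Definition stopping_time (x p : R) (tau : Omega -> \bar R) : Prop :=
  (forall o, (0 <= tau o)%E) /\
  forall t, 0 <= t -> filtration x p t [set o | (tau o <= t%:E)%E].

(* The value at [-oo] is irrelevant since stopping times are nonnegative. *)
Definition payoff (x p : R) (tau : Omega -> \bar R) (o : Omega) : \bar R :=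
  if tau o is t%:E then
    ((expR (- r * t))%:E *
     (\int[lebesgue_measure]_(s in `[0%R, +oo[)
        (expR (- r * s) * X x p (t + s) o)%:E - I%:E))%E
  else 0%E.

(* The payoff is measurable only for the P-completion of the Borel
   sigma-algebra. The library integral, being defined for all functions as a
   supremum over Borel simple functions of the positive part minus the same for
   the negative part, agrees with the integral against the completion. *)
Definition value (x p : R) : \bar R :=
  ereal_sup [set (\int[Pr]_o payoff x p tau o)%E
            | tau in stopping_time x p].

Definition g (x p : R) : R :=
  x * ((1 - p) / (r - mu0) + p / (r - mu1)) - I.

Definition stopping_set : set (R * R) :=
  [set xp | [/\ 0 < xp.1, 0 <= xp.2 <= 1 &
                value xp.1 xp.2 = (g xp.1 xp.2)%:E]].

End Model.

(* Main.v *)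
Require Import Defs.
From mathcomp Require Import all_boot all_order all_algebra.
From mathcomp Require Import all_classical all_reals all_analysis.
From mathcomp Require Import measurable_realfun.
From mathcomp Require Import lra ring.

(** The revenue part of the payoff is linear in the initial state: with
    Y = X^(1,p) and P_t = \int_t^oo e^(-r s) Y_s ds, stopping at tau = t pays
    x P_t - e^(-r t) I.  Since Y is positive, P_t <= P_0 for every path.  Hence,
    for x <= y, whatever the stopping rule,

      payoff from y <= payoff from x + (y - x) P_0                     (1)

    pointwise: of the additional revenue generated by a higher initial state,
    immediate investment collects the largest possible share.

    The mean of P_0 is (1 - p) / (r - mu0) + p / (r - mu1), so the mean of
    (y - x) P_0 is exactly g(y, p) - g(x, p), and investing at once has mean
    payoff g(y, p).  The processes X^(x,p) and X^(y,p) are multiples of one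
    another, so they have the same stopping times.  If (x, p) is in the
    stopping set, every stopping time has mean payoff at most g(x, p) from x,
    hence, by (1), at most g(y, p) from y; the stopping time 0 attains this
    bound.

    Two points carry the technical weight.

    - A payoff is measurable only for the completed sigma-algebra, whereas the
      integral is built from Borel simple functions and is not additive outside
      Borel functions.  [le_integral_add] derives the integrated form of (1)
      from the pointwise one for arbitrary functions: if h lies
      below the positive part of the left side (or the negative part of f on
      the right), the positive part of h - K lies below the positive part of f
      (or the negative part of the left side).

    - The mean of P_0 ([expected_perpetuity]) is computed by Tonelli's theorem,
      which rests on the joint measurability of (t, w) |-> w(t)
      ([measurable_path_at2]), on the exponential moments of the Wiener measure
      ([wiener_expR]) and on the uniform law of the first coordinate. *)

Set Implicit Arguments.
Unset Strict Implicit.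
Unset Printing Implicit Defensive.

Import Order.TTheory GRing.Theory Num.Theory.
Import numFieldNormedType.Exports.

Local Open Scope classical_set_scope.
Local Open Scope ring_scope.

(** * Integral inequalities for functions that need not be measurable *)

(** The pointwise content of [le_integral_posneg_shift], with v, u and c the
    values of f', f and K, and a, b those of simple functions below the positive
    part of f' and the negative part of f.  Whenever a > c, v >= a is positive
    and u >= a - c; whenever b > c, u <= - b is negative and v <= c - b.  If a
    and b are both positive then a <= v <= u + c <= c - b. *)
Lemma truncated_shift_bounds (R : realType) (a b : R) (c u v : \bar R) :
  0 <= a -> 0 <= b -> (0 <= c)%E -> (v <= u + c)%E ->
  (a%:E <= maxe v 0)%E -> (b%:E <= maxe (- u) 0)%E ->
  [/\ maxe (a%:E - c) 0 <= maxe u 0, maxe (b%:E - c) 0 <= maxe (- v) 0 &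
      a%:E + b%:E <= maxe (a%:E - c) 0 + maxe (b%:E - c) 0 + c]%E.
Proof.
move=> a0 b0; case: c => [c||]// c0 vuc av bu; last first.
  have maxNy x : (maxe (x%:E - +oo) 0 = 0 :> \bar R)%E by exact/max_idPr/leNye.
  by rewrite !maxNy !adde0 add0e leey !le_max lexx !orbT.
have [ac0 ac1] : 0 <= Num.max (a - c) 0 /\ a - c <= Num.max (a - c) 0.
  by rewrite !le_max !lexx orbT.
have [bc0 bc1] : 0 <= Num.max (b - c) 0 /\ b - c <= Num.max (b - c) 0.
  by rewrite !le_max !lexx orbT.
suff [H1 H2 H3] : [/\ a - c <= 0 \/ ((a - c)%:E <= u)%E,
    b - c <= 0 \/ ((b - c)%:E <= - v)%E &
    a + b <= Num.max (a - c) 0 + Num.max (b - c) 0 + c].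
  rewrite -!EFinB -!EFin_max -!EFinD !lee_fin; split => //.
    rewrite EFin_max ge_max !le_max lexx orbT andbT lee_fin.
    by case: H1 => ->; rewrite ?orbT.
  rewrite EFin_max ge_max !le_max lexx orbT andbT lee_fin.
  by case: H2 => ->; rewrite ?orbT.
move: c0 vuc av bu; rewrite lee_fin !le_max; move: u v => [u||] [v||] //=.
all: rewrite -?EFinN -?EFinD ?lee_fin ?leeNy_eq ?leye_eq ?leey ?leNye //=.
all: move=> c0 vuc.
- case/orP => av /orP[] bu; split; first [lra|by left; lra|by right; lra].
- by move=> av _; split; [left; lra|right|lra].
- by move=> _ bu; split; [right|left; lra|lra].
- by move=> _ bu; split; [right|left; lra|lra].
- by move=> av bu; split; [right|right|lra].
- by move=> av _; split; [left; lra|right|lra].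
Qed.

Section LowerIntegral.
Local Open Scope ereal_scope.

Lemma ereal_supD_le (R : realType) (A B : set \bar R) (z : \bar R) :
  A 0 -> B 0 -> (forall a, A a -> 0 <= a) -> (forall b, B b -> 0 <= b) ->
  (forall a b, A a -> B b -> a + b <= z) -> ereal_sup A + ereal_sup B <= z.
Proof.
move=> A0 B0 Age0 Bge0 ABz.
have z0 : 0 <= z by rewrite -[leLHS]adde0; exact: ABz.
have supA0 : 0 <= ereal_sup A by exact: ereal_sup_ubound.
case: z z0 ABz => [z||]// z0 ABz; last by rewrite leey.
have fin c : 0 <= c -> c <= z%:E -> c \is a fin_num.
  by move=> c0 cz; rewrite ge0_fin_numE// (le_lt_trans cz)// ltry.
have supAz b : B b -> ereal_sup A <= z%:E - b.
  move=> Bb; apply: ge_ereal_sup => a Aa; rewrite leeBrDr; first exact: ABz.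
  by apply: fin; [exact: Bge0|rewrite -[leLHS]add0e; exact: ABz].
have supAfin : ereal_sup A \is a fin_num.
  by apply: fin => //; have := supAz _ B0; rewrite sube0.
rewrite addeC -leeBrDr//; apply: ge_ereal_sup => b Bb.
have bfin : b \is a fin_num.
  by apply: fin; [exact: Bge0|rewrite -[leLHS]add0e; exact: ABz].
by rewrite leeBrDr// addeC -leeBrDr// supAz.
Qed.

Context d (T : measurableType d) (R : realType).
Variable mu : {measure set T -> \bar R}.
Import HBNNSimple.

(** Nonnegative functions are integrated by a supremum over simple functions,
    which makes this monotonicity free of measurability conditions. *)
Lemma le_integral_nonneg (f g : T -> \bar R) :
  (forall x, 0 <= f x) -> (forall x, f x <= g x) ->
  \int[mu]_x f x <= \int[mu]_x g x.
Proof.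
move=> f0 fg; rewrite !ge0_integralTE//; last first.
  by move=> x; exact: le_trans (f0 x) (fg x).
apply: ereal_sup_le => _ [h hf <-]; exists h => //.
by move=> x; exact: le_trans (hf x) (fg x).
Qed.

(** For measurable functions this is the integral of f' <= f + K after moving
    the negative parts to the other sides.  Additivity fails in general, so the
    pair (h1, h2) of simple functions below f'^+ and f^- is carried over to the
    measurable pair of positive parts of h1 - K and h2 - K, which lies below
    (f^+, f'^-); additivity is used between measurable functions only. *)
Lemma le_integral_posneg_shift (f f' K : T -> \bar R) :
  measurable_fun setT K -> (forall x, 0 <= K x) ->
  (forall x, f' x <= f x + K x) ->
  \int[mu]_x f'^\+ x + \int[mu]_x f^\- x <=
  \int[mu]_x f^\+ x + \int[mu]_x f'^\- x + \int[mu]_x K x.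
Proof.
move=> mK K0 f'fK; set rhs := _ + _ + _.
suff main (h1 h2 : {nnsfun T >-> R}) : (forall x, (h1 x)%:E <= f'^\+ x) ->
    (forall x, (h2 x)%:E <= f^\- x) ->
    sintegral mu h1 + sintegral mu h2 <= rhs.
  rewrite [X in X + _]ge0_integralTE; last by move=> x; exact: funepos_ge0.
  rewrite [X in _ + X]ge0_integralTE; last by move=> x; exact: funeneg_ge0.
  apply: ereal_supD_le.
  - by exists nnsfun0; [move=> x; exact: funepos_ge0|exact: sintegral0].
  - by exists nnsfun0; [move=> x; exact: funeneg_ge0|exact: sintegral0].
  - by move=> _ [h _ <-]; exact: sintegral_ge0.
  - by move=> _ [h _ <-]; exact: sintegral_ge0.
  - by move=> _ _ [h1 ? <-] [h2 ? <-]; exact: main.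
move=> h1f' h2f.
pose k (h : {nnsfun T >-> R}) x := maxe ((h x)%:E - K x) 0.
have mk h : measurable_fun setT (k h).
  apply: measurable_maxe => //; apply: emeasurable_funB => //.
  by apply/measurable_EFinP.
have k0 h x : 0 <= k h x by rewrite /k le_max lexx orbT.
rewrite -!integralT_nnsfun -ge0_integralD//; last 4 first.
- by move=> x _; rewrite lee_fin.
- by apply/measurable_EFinP.
- by move=> x _; rewrite lee_fin.
- by apply/measurable_EFinP.
have pt x : [/\ k h1 x <= f^\+ x, k h2 x <= f'^\- x &
    (h1 x)%:E + (h2 x)%:E <= k h1 x + k h2 x + K x].
  rewrite funeposE funenegE; apply: truncated_shift_bounds => //.
  - by have := h1f' x; rewrite funeposE.
  - by have := h2f x; rewrite funenegE.
apply: (@le_trans _ _ (\int[mu]_x (k h1 x + k h2 x + K x))).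
  apply: le_integral_nonneg.
    by move=> x; rewrite adde_ge0// lee_fin.
  by move=> x; have [] := pt x.
rewrite ge0_integralD//; last 2 first.
- by move=> x _; rewrite adde_ge0.
- exact: emeasurable_funD.
rewrite ge0_integralD// leeD2r// leeD//.
  by apply: le_integral_nonneg => // x; have [] := pt x.
by apply: le_integral_nonneg => // x; have [] := pt x.
Qed.

(** The finiteness of the negative parts only serves to subtract them. *)
Lemma le_integral_add (f f' K : T -> \bar R) :
  measurable_fun setT K -> (forall x, 0 <= K x) ->
  (forall x, f' x <= f x + K x) ->
  \int[mu]_x f^\- x < +oo -> \int[mu]_x f'^\- x < +oo ->
  \int[mu]_x f' x <= \int[mu]_x f x + \int[mu]_x K x.
Proof.
move=> mK K0 f'fK foo f'oo.
have ge0 (h : T -> \bar R) : 0 <= \int[mu]_x h^\- x.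
  by apply: integral_ge0 => x _; exact: funeneg_ge0.
rewrite (integralE mu setT f) (integralE mu setT f').
rewrite leeBlDr ?ge0_fin_numE//.
have := le_integral_posneg_shift mK K0 f'fK.
rewrite -leeBrDr ?ge0_fin_numE// => le_pos; apply: (le_trans le_pos).
rewrite (addeAC _ (\int[mu]_x K x)) (addeAC (\int[mu]_x f^\+ x)).
by rewrite (addeAC _ (\int[mu]_x f'^\- x)).
Qed.
End LowerIntegral.

(** * Measurability of path evaluation *)

Section Paths.
Variable R : realType.

Lemma val_to_Rplus (t : R) : set_val (to_Rplus t) = Num.max t 0.
Proof.
rewrite set_valE /to_Rplus /insubd; case: insubP => [u + ut|].
  by rewrite inE /= in_itv /= andbT => t0; rewrite max_l.
rewrite notin_setE /= in_itv /= andbT => /negP.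
by rewrite -ltNge => /ltW t0; rewrite max_r.
Qed.

Lemma continuous_to_Rplus : continuous (@to_Rplus R).
Proof.
apply: continuous_comp_initial => t.
rewrite (_ : _ \o _ = (fun t : R => Num.max t 0)); last first.
  by apply/funext => s /=; rewrite val_to_Rplus.
by apply: continuous_max; [exact: cvg_id|exact: cvg_cst].
Qed.

Lemma continuous_path_at (w : CRplus R) : continuous (path_at w : R -> R).
Proof.
move=> t; apply: (@continuous_comp _ _ _ (@to_Rplus R)).
  exact: continuous_to_Rplus.
exact: cts_fun.
Qed.

(** Evaluation at t is continuous: the singleton {t} is compact. *)
Lemma open_path_at (t : R) (V : set R) :
  open V -> open [set w : CRplus R | V (path_at w t)].
Proof.
move=> oV; exists [set f | f @` [set to_Rplus t] `<=` V].
  by apply: compact_open_open => //; exact: compact_set1.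
apply/seteqP; split => w /=.
  by move=> /(_ (path_at w t)); apply; exists (to_Rplus t).
by move=> Vw _ [_ -> <-].
Qed.

Lemma measurable_path_at (t : R) :
  measurable_fun setT (fun w : borel (CRplus R) => path_at w t).
Proof.
apply: (measurability _ (RGenOpens.measurableE R)) => //.
move=> _ [_ [a [b ->] <-]]; rewrite setTI; apply: sub_sigma_algebra.
by apply: open_path_at; exact: interval_open.
Qed.

Lemma measurable_truncn_fiber (k : nat) :
  measurable [set x : R | Num.truncn x = k].
Proof.
have mlt n : measurable [set x : R | (Num.truncn x <= n)%N].
  rewrite (_ : [set _ | _] = `]-oo, n.+1%:R[%classic)//.
  by apply/seteqP; split => x /=; rewrite in_itv/= truncn_le_nat.
case: k => [|k].
  rewrite (_ : [set _ | _] = [set x : R | (Num.truncn x <= 0)%N])//.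
  by apply/seteqP; split => x /=; [move=> ->|rewrite leqn0 => /eqP].
rewrite (_ : [set _ | _] = [set x : R | (Num.truncn x <= k.+1)%N] `\`
  [set x : R | (Num.truncn x <= k)%N]); first exact: measurableD.
apply/seteqP; split => x /=; first by move=> ->; rewrite ltnn.
by move=> [xk /negP]; rewrite -ltnNge => kx; apply/eqP; rewrite eqn_leq xk.
Qed.

Lemma cvg_truncn_div (t : R) : 0 <= t ->
  (Num.truncn (n.+1%:R * t))%:R / n.+1%:R @[n --> \oo] --> t.
Proof.
move=> t0; apply: (@squeeze_cvgr _ _ _ _ (fun n => t - n.+1%:R^-1) (cst t)).
- near=> n; have := @truncn_itv R (n.+1%:R * t); rewrite mulr_ge0// => /(_ isT).
  move=> /andP[lo hi]; apply/andP; split.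
    by rewrite ler_pdivlMr// mulrBl mulVf// lerBlDr natr1 mulrC ltW.
  by rewrite ler_pdivrMr// [leRHS]mulrC lo.
- rewrite -[X in _ --> X]subr0; apply: cvgB; first exact: cvg_cst.
  exact: cvg_harmonic.
- exact: cvg_cst.
Unshelve. all: by end_near. Qed.

(** Paths are continuous, so w(t) is the limit of the values of w on the grids
    of mesh 1/(n+1) to the left of t; on a grid, the evaluation is a countable
    gluing of maps depending on w alone. *)
Lemma measurable_path_at2 :
  measurable_fun setT
    (fun tw : measurableTypeR R * borel (CRplus R) => path_at tw.2 tw.1).
Proof.
pose grid n (t : R) := (Num.truncn (n.+1%:R * t))%:R / n.+1%:R : R.
apply: (@measurable_fun_cvg _ _ _ _
  (fun n (tw : measurableTypeR R * borel (CRplus R)) =>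
     path_at tw.2 (grid n tw.1))).
  move=> n _ B mB; rewrite setTI.
  rewrite (_ : _ @^-1` B = \bigcup_k
    ([set t | Num.truncn (n.+1%:R * t) = k] `*`
     [set w : borel (CRplus R) | B (path_at w (k%:R / n.+1%:R))])); last first.
    apply/seteqP; split => [[t w]/= Bw|[t w] [k _ [/= <-]]//].
    by exists (Num.truncn (n.+1%:R * t)).
  apply: bigcupT_measurable => k; apply: measurableX.
    rewrite -[X in measurable X]setTI.
    have mM : measurable_fun setT (fun t : R => n.+1%:R * t).
      by apply: measurable_funM.
    exact: mM (measurable_truncn_fiber k).
  by rewrite -[X in measurable X]setTI; exact: measurable_path_at.
(* Negative times are read as time 0, and so are their grid points. *)
move=> [t w] _ /=; have [t0|/ltW t0] := leP 0 t.
  apply: continuous_cvg; first exact: continuous_path_at.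
  exact: cvg_truncn_div.
have path0 s : s <= 0 -> path_at w s = path_at w 0.
  move=> s0; rewrite /path_at; congr (_ _); apply: val_inj.
  by rewrite -!set_valE !val_to_Rplus !max_r.
rewrite (_ : (fun _ => _) = cst (path_at w t)); first exact: cvg_cst.
apply/funext => n /=; rewrite [RHS]path0//; apply: path0.
rewrite /grid (_ : Num.truncn _ = 0%N) ?mul0r//.
apply/truncn0Pn.
by rewrite -ltNge (le_lt_trans _ ltr01)// mulr_ge0_le0.
Qed.

End Paths.

(** * Exponential moments of the underlying laws *)

Section Density.
Local Open Scope ereal_scope.
Context d (T : measurableType d) (R : realType).
Variables (mu nu : {measure set T -> \bar R}) (f : T -> R).
Hypotheses (mf : measurable_fun setT f) (f0 : forall x, (0 <= f x)%R).
Hypothesis nuE : forall A, measurable A -> nu A = \int[mu]_(x in A) (f x)%:E.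
Import HBNNSimple.

Let mEf : measurable_fun setT (EFin \o f). Proof. exact/measurable_EFinP. Qed.
Let Ef0 x : 0 <= (f x)%:E. Proof. by rewrite lee_fin. Qed.

Let integral_density_nnsfun (h : {nnsfun T >-> R}) :
  \int[nu]_x (h x)%:E = \int[mu]_x ((f x)%:E * (h x)%:E).
Proof.
rewrite integralT_nnsfun sintegralE.
under [RHS]eq_integral.
  move=> x _; rewrite fimfunE -fsumEFin// ge0_mule_fsumr; last first.
    by move=> r; rewrite EFinM nnfun_muleindic_ge0.
  over.
rewrite ge0_integral_fsum//; last 2 first.
- move=> r; apply: emeasurable_funM => //; apply/measurable_EFinP.
  by apply: measurable_funM => //; exact: measurable_indic.
- by move=> r x _; rewrite mule_ge0// EFinM nnfun_muleindic_ge0.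
apply: eq_fsbigr => r /set_mem[y _ <-].
rewrite nuE// integral_mkcond -ge0_integralZl//; last 3 first.
- by apply/(measurable_restrictT _ _).1 => //; exact: measurable_funTS.
- by move=> x _; rewrite erestrict_ge0.
- by rewrite lee_fin.
by apply: eq_integral => x _; rewrite epatch_indic/= EFinM muleCA.
Qed.

(** Proved for simple functions by [nuE] on their level sets, then by monotone
    convergence. *)
Lemma ge0_integral_density (g : T -> \bar R) : measurable_fun setT g ->
  (forall x, 0 <= g x) -> \int[nu]_x g x = \int[mu]_x ((f x)%:E * g x).
Proof.
move=> mg g0; pose g_ := nnsfun_approx measurableT mg.
transitivity (limn (fun n => \int[nu]_x (g_ n x)%:E)).
  rewrite -monotone_convergence//=.
  - apply: eq_integral => x _; apply/esym/cvg_lim => //.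
    exact: cvg_nnsfun_approx.
  - by move=> n; exact/measurable_EFinP/measurable_funTS.
  - by move=> n x _; rewrite lee_fin.
  - by move=> x _ m n mn; rewrite lee_fin; exact/lefP/nd_nnsfun_approx.
under eq_fun do rewrite integral_density_nnsfun.
rewrite -monotone_convergence//=.
- apply: eq_integral => x _; apply/cvg_lim => //; apply: cvgeZl => //.
  exact: cvg_nnsfun_approx.
- move=> n; apply: emeasurable_funM => //.
  exact/measurable_EFinP/measurable_funTS.
- by move=> n x _; rewrite mule_ge0// lee_fin.
- move=> x _ m n mn; rewrite lee_pmul// lee_fin//; exact/lefP/nd_nnsfun_approx.
Qed.
End Density.

Section Laws.
Variable R : realType.

(** Completing the square: a y - y^2 / (2 s^2) equals
    a^2 s^2 / 2 - (y - a s^2)^2 / (2 s^2), so tilting the centered normal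
    density by e^(a y) gives a multiple of the normal density of mean a s^2. *)
Lemma normal_prob_expR (a s : R) : s != 0 ->
  (\int[normal_prob 0 s]_y (expR (a * y))%:E =
   (expR (a ^+ 2 * s ^+ 2 / 2))%:E)%E.
Proof.
move=> s0.
rewrite (@ge0_integral_density _ _ _ lebesgue_measure _
  (normal_pdf 0 s)) //; last first.
- by apply/measurable_EFinP; apply: measurableT_comp => //;
    exact: measurable_funM.
- by move=> y; exact: normal_pdf_ge0.
- exact: measurable_normal_pdf.
transitivity (\int[lebesgue_measure]_y ((expR (a ^+ 2 * s ^+ 2 / 2))%:E *
   (normal_pdf (a * s ^+ 2) s y)%:E))%E.
  apply: eq_integral => y _; rewrite -!EFinM; congr EFin.
  have e : normal_fun 0 s y * expR (a * y) =
      expR (a ^+ 2 * s ^+ 2 / 2) * normal_fun (a * s ^+ 2) s y.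
    by rewrite /normal_fun -!expRD; congr expR; field.
  rewrite /normal_pdf (negbTE s0)/= -(mulrA (normal_peak s)) e.
  by rewrite (mulrCA (normal_peak s)).
rewrite ge0_integralZl//; last 2 first.
- by apply/measurable_EFinP; exact: measurable_normal_pdf.
- by move=> y _; rewrite lee_fin normal_pdf_ge0.
by rewrite integral_normal_pdf mule1.
Qed.

Lemma measurable_val_le (p : R) :
  measurable_fun setT (fun u : borel (unit_interval R) => \val u <= p).
Proof.
apply: (measurable_fun_bool true).
rewrite setTI -[X in measurable X]setCK; apply: measurableC.
apply: sub_sigma_algebra.
exists [set t : R | p < t]; first exact: open_gt.
by apply/seteqP; split => u /=; rewrite ltNge => /negP.
Qed.

Lemma integral_uniform_unit_threshold (p a b : R) :
  0 <= p <= 1 -> 0 <= a -> 0 <= b ->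
  (\int[uniform_unit R]_u (if (\val u <= p)%R then a%:E else b%:E) =
   (p * a + (1 - p) * b)%:E)%E.
Proof.
move=> /andP[p0 p1] a0 b0.
pose f (u : borel (unit_interval R)) : \bar R :=
  if (\val u <= p)%R then a%:E else b%:E.
have mf : measurable_fun setT f.
  by apply: measurable_fun_if => //; exact: measurable_val_le.
have f0 u : (0 <= f u)%E by rewrite /f; case: ifP; rewrite lee_fin.
rewrite -[LHS]/(\int[uniform_unit R]_u f u)%E.
rewrite /uniform_unit ge0_integral_distribution//.
rewrite integral_uniform; [|exact: measurableT_comp|by move=> t; exact: f0].
rewrite subr0 invr1 mul1e.
have val_unit t : 0 <= t <= 1 -> \val (to_unit t) = t.
  move=> t01; rewrite /to_unit /insubd; case: insubP => [u _ <-//|].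
  by rewrite notin_setE/= in_itv/= t01.
transitivity (\int[lebesgue_measure]_(t in `[0%R, p] `|` `]p, 1%R])
    (f \o @to_unit R) t)%E.
  congr integral; apply/seteqP; split => t /=; rewrite !in_itv/=.
    move=> /andP[t0 t1]; rewrite t0 t1 andbT.
    by case: (leP t p) => ?; [left|right].
  move=> [/andP[-> tp]|/andP[pt ->]]; first exact: le_trans tp p1.
  by rewrite andbT (le_trans p0)// ltW.
rewrite ge0_integral_setU//=; last 2 first.
- by apply: measurable_funTS; exact: measurableT_comp.
- apply/disj_setPS => t /= []; rewrite !in_itv/= => /andP[_ tp] /andP[pt _].
  by move: (le_lt_trans tp pt); rewrite ltxx.
have -> : (\int[lebesgue_measure]_(t in `[0%R, p]) f (to_unit t) =
    \int[lebesgue_measure]_(t in `[0%R, p]) cst a%:E t)%E.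
  apply: eq_integral => t; rewrite inE/= in_itv/= => /andP[t0 tp].
  by rewrite /f val_unit ?tp// t0 (le_trans tp).
have -> : (\int[lebesgue_measure]_(t in `]p, 1%R]) f (to_unit t) =
    \int[lebesgue_measure]_(t in `]p, 1%R]) cst b%:E t)%E.
  apply: eq_integral => t; rewrite inE/= in_itv/= => /andP[pt t1].
  have t0 : 0 <= t by rewrite (le_trans p0)// ltW.
  by rewrite /f val_unit ?t0// leNgt pt.
rewrite !integral_cst//= !lebesgue_measure_itv/= !lte_fin.
rewrite oppr0 adde0.
have -> : (if 0 < p then p%:E else 0%E) = p%:E :> \bar R.
  by case: ltgtP p0 => // <-.
have -> : (if p < 1 then (1%:E - p%:E)%E else 0%E) = (1 - p)%:E :> \bar R.
  by case: ltgtP p1 => // ->; rewrite subrr.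
by rewrite -!EFinM -EFinD (mulrC a) (mulrC b).
Qed.

(** Paths start at 0 almost surely, so w(t) may be replaced by the increment
    w(t) - w(0), whose law for t > 0 is the centered normal law of variance t.
    The time t = 0 is separate, as it carries no increment. *)
Lemma wiener_expR (W : probability (borel (CRplus R)) R) (a t : R) :
  wiener_measure W -> 0 <= t ->
  (\int[W]_w (expR (a * path_at w t))%:E = (expR (a ^+ 2 / 2 * t))%:E)%E.
Proof.
move=> [W0 Winc] t0.
have mp := @measurable_path_at R.
pose inc w : R := path_at w t - path_at w 0.
have minc : measurable_fun setT (inc : borel (CRplus R) -> measurableTypeR R).
  by apply: measurable_funB; exact: mp.
transitivity (\int[W]_w (expR (a * inc w))%:E)%E.
  apply: ge0_ae_eq_integral => //.
  - apply/measurable_EFinP; apply: measurableT_comp => //.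
    by apply: measurable_funM => //; exact: mp.
  - apply/measurable_EFinP; apply: measurableT_comp => //.
    exact: measurable_funM.
  have mZ : measurable ([set w | path_at w 0 = 0] : set (borel (CRplus R))).
    by have := mp 0 measurableT [set 0] (measurable_set1 0); rewrite setTI.
  exists (~` [set w | path_at w 0 = 0]); split.
  - exact: measurableC.
  - have := probability_setC W mZ; rewrite W0 subee//; exact.
  - move=> w /= nE w0; apply: nE => _; by rewrite /inc w0 subr0.
move: t0; rewrite le_eqVlt => /predU1P[t0|t0].
  rewrite -t0 mulr0 expR0.
  rewrite (eq_integral (cst 1%E)); last first.
    by move=> w _; rewrite /inc -t0 subrr mulr0 expR0.
  by rewrite integral_cst//= probability_setT mul1e.
(* A single increment, from time 0 to time t: any sequence of times that starts
   with 0 and t will do. *)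
have law B : measurable B ->
    pushforward W inc B = normal_prob 0 (Num.sqrt t) B.
  move=> mB; have := Winc 1%N (fun i => if i is 0%N then 0 else t) (fun=> B).
  rewrite bigcap_mkord !big_ord1 /= subr0; apply => //.
  by move=> [].
have := @normal_prob_expR a (Num.sqrt t).
rewrite gt_eqF ?sqrtr_gt0// => /(_ isT); rewrite sqr_sqrtr ?(ltW t0)//.
move=> E; rewrite mulrAC -E.
have := @ge0_integral_pushforward _ _ _ _ _ _ minc W setT
  (fun y : measurableTypeR R => (expR (a * y))%:E) measurableT.
rewrite preimage_setT => <-; last 2 first.
- by apply/measurable_EFinP; apply: measurableT_comp => //;
    exact: measurable_funM.
- by move=> y _; rewrite lee_fin expR_ge0.
apply: eq_measure_integral => B mB _; exact: law.
Qed.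

End Laws.

Lemma continuous_expR_comp (R : realType) (f : R -> R) :
  continuous f -> continuous (fun t => expR (f t)).
Proof.
by move=> cf t; apply: continuous_comp; [exact: cf|exact: continuous_expR].
Qed.

(** The exponential density has mass 1. *)
Lemma integral_expRN (R : realType) (k : R) : 0 < k ->
  (\int[lebesgue_measure]_(s in `[0%R, +oo[) (expR (- k * s))%:E = (k^-1)%:E)%E.
Proof.
move=> k0; have mexp (A : set R) :
    measurable_fun A (fun s => (expR (- k * s))%:E).
  apply/measurable_EFinP; apply: measurable_funTS.
  apply: continuous_measurable_fun; apply: continuous_expR_comp.
  exact: mulrl_continuous.
have mass1 : (k%:E *
    \int[lebesgue_measure]_(s in `[0%R, +oo[) (expR (- k * s))%:E = 1)%E.
  rewrite -ge0_integralZl; [|exact: measurable_itv|exact: mexp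
    |by move=> s _; rewrite lee_fin expR_ge0|by rewrite lee_fin ltW].
  rewrite -(integral_exponential_pdf k0) integral_mkcond.
  by apply: eq_integral => s _; rewrite /exponential_pdf !patchE; case: ifP.
have := congr1 (fun z => (k^-1)%:E * z)%E mass1.
rewrite muleA -EFinM mulVf ?gt_eqF//.
by rewrite mul1e mule1.
Qed.

(** * Payoffs along a path *)

Section Perpetuity.
Variables (R : realType) (r sigma mu0 mu1 p : R).
Local Notation X := (X sigma mu0 mu1).
Local Notation mu := lebesgue_measure.

Lemma X_scale x t (o : Omega R) : X x p t o = x * X 1 p t o.
Proof. by rewrite /Defs.X mul1r. Qed.

Lemma X1_ge0 t (o : Omega R) : 0 <= X 1 p t o.
Proof. by rewrite /Defs.X mul1r expR_ge0. Qed.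

Lemma continuous_X (o : Omega R) : continuous (fun t => X 1 p t o).
Proof.
move=> t; pose g t : R := (drift mu0 mu1 p o - sigma ^+ 2 / 2) * t.
apply: (continuousM (s := cst 1)
  (t := fun t => expR (g t + sigma * path_at o.2 t))).
  exact: cst_continuous.
apply: continuous_expR_comp => {}t.
apply: (continuousD (f := g) (g := fun t => sigma * path_at o.2 t)).
  exact: mulrl_continuous.
apply: (continuousM (s := cst sigma) (t := path_at o.2)).
  exact: cst_continuous.
exact: continuous_path_at.
Qed.

(** Revenue rate of a project with initial state 1, discounted to time 0. *)
Definition flow (o : Omega R) (s : R) : R := expR (- r * s) * X 1 p s o.

Lemma flow_ge0 o s : 0 <= flow o s.
Proof. by rewrite mulr_ge0 ?expR_ge0 ?X1_ge0. Qed.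

Lemma continuous_flow o : continuous (flow o).
Proof.
move=> s; apply: (continuousM (s := fun s => expR (- r * s))
  (t := fun s => X 1 p s o)); last exact: continuous_X.
by apply: continuous_expR_comp; exact: mulrl_continuous.
Qed.

(** The random variable P_t: value at time 0, for the initial state 1, of the
    revenue earned from t on. *)
Definition perpetuity (t : R) (o : Omega R) : \bar R :=
  (\int[mu]_(s in `[t, +oo[) (flow o s)%:E)%E.

Lemma perpetuity_ge0 t o : (0 <= perpetuity t o)%E.
Proof. by apply: integral_ge0 => s _; rewrite lee_fin flow_ge0. Qed.

Lemma measurable_flow_path (A : set R) o :
  measurable_fun A (fun s => (flow o s)%:E).
Proof.
apply/measurable_EFinP; apply: measurable_funTS.
by apply: continuous_measurable_fun; exact: continuous_flow.
Qed.

Lemma perpetuity_le t o : 0 <= t -> (perpetuity t o <= perpetuity 0 o)%E.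
Proof.
move=> t0; apply: ge0_subset_integral => //.
- exact: measurable_flow_path.
- by move=> s _; rewrite lee_fin flow_ge0.
- by move=> s /=; rewrite !in_itv/= !andbT; exact: le_trans.
Qed.

Lemma continuous_shift_X (t : R) (o : Omega R) :
  continuous (fun s => expR (- r * s) * X 1 p (t + s) o).
Proof.
move=> s; apply: (continuousM (s := fun s => expR (- r * s))
  (t := fun s => X 1 p (t + s) o)).
  by apply: continuous_expR_comp; exact: mulrl_continuous.
apply: (continuous_comp (f := fun s => t + s) (g := fun s => X 1 p s o));
  last exact: continuous_X.
by apply: (continuousD (f := cst t) (g := id));
  [exact: cst_continuous|exact: cvg_id].
Qed.

(** Discounting commutes with the time shift; substitute t + s for s. *)
Lemma integral_shift_X (t : R) o :
  ((expR (- r * t))%:E *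
    \int[mu]_(s in `[0%R, +oo[) (expR (- r * s) * X 1 p (t + s) o)%:E =
   perpetuity t o)%E.
Proof.
rewrite -ge0_integralZl//; last 2 first.
- apply/measurable_EFinP; apply: measurable_funTS.
  by apply: continuous_measurable_fun; exact: continuous_shift_X.
- by move=> s _; rewrite lee_fin mulr_ge0 ?expR_ge0 ?X1_ge0.
pose F (s : R) := t + s.
have F' : F^`()%classic = cst 1.
  apply/funext => s; rewrite /F derive1E deriveD// derive_cst add0r.
  exact: derive_id.
have F0 : F 0 = t by rewrite /F addr0.
transitivity (\int[mu]_(s in `[F 0%R, +oo[) (flow o s)%:E)%E; last first.
  by rewrite F0.
rewrite (@increasing_ge0_integration_by_substitutiony _ F (flow o) 0).
- apply: eq_integral => s _; rewrite F' /= -EFinM; congr EFin.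
  by rewrite fctE/= mulr1 /flow /F mulrA -expRD mulrDr.
- by move=> x y _ _ xy; rewrite /F ltrD2l.
- by rewrite F' => x _; exact: cst_continuous.
- by rewrite F'; exact: is_cvg_cst.
- by rewrite F'; exact: is_cvg_cst.
- split; first by move=> x _; apply: derivableD.
  apply: cvg_at_right_filter; apply: cvgD; [exact: cvg_cst|exact: cvg_id].
- exact: cvg_addrl.
- by apply: continuous_subspaceT; exact: continuous_flow.
- by move=> x _; exact: flow_ge0.
Qed.

Lemma payoffE (I x : R) (tau : Omega R -> \bar R) o : 0 <= x ->
  payoff I r sigma mu0 mu1 x p tau o =
  if tau o is t%:E then
    (x%:E * perpetuity t o - (expR (- r * t) * I)%:E)%E else 0%E.
Proof.
move=> x0; rewrite /payoff; case: (tau o) => // t.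
have -> : (\int[mu]_(s in `[0%R, +oo[) (expR (- r * s) * X x p (t + s) o)%:E =
    x%:E *
    \int[mu]_(s in `[0%R, +oo[) (expR (- r * s) * X 1 p (t + s) o)%:E)%E.
  rewrite -ge0_integralZl//; last 2 first.
  - apply/measurable_EFinP; apply: measurable_funTS.
    by apply: continuous_measurable_fun; exact: continuous_shift_X.
  - by move=> s _; rewrite lee_fin mulr_ge0 ?expR_ge0 ?X1_ge0.
  by apply: eq_integral => s _; rewrite X_scale mulrCA EFinM.
rewrite muleBr; [|by []|by apply: fin_num_adde_defl].
by rewrite muleCA integral_shift_X EFinM.
Qed.

Lemma payoff_ge (I x : R) (tau : Omega R -> \bar R) o : 0 < r -> 0 <= I ->
  0 <= x -> (0 <= tau o)%E ->
  ((- I)%:E <= payoff I r sigma mu0 mu1 x p tau o)%E.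
Proof.
move=> r0 I0 x0; rewrite payoffE//; case: (tau o) => [t||]//.
  rewrite lee_fin => t0; rewrite -[leLHS]add0e EFinN.
  apply: leeB; first by rewrite mule_ge0 ?lee_fin// perpetuity_ge0.
  by rewrite lee_fin ler_piMl// -expR0 ler_expR mulNr oppr_le0 mulr_ge0// ltW.
by move=> _; rewrite lee_fin oppr_le0.
Qed.

(** The additional revenue is (y - x) P_t when stopping at t, and 0 when never
    stopping; both are at most (y - x) P_0. *)
Lemma payoff_le_add (I x y : R) (tau : Omega R -> \bar R) o :
  0 <= x -> x <= y -> (0 <= tau o)%E ->
  (payoff I r sigma mu0 mu1 y p tau o <=
   payoff I r sigma mu0 mu1 x p tau o + (y - x)%:E * perpetuity 0 o)%E.
Proof.
move=> x0 xy; have y0 := le_trans x0 xy.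
rewrite !payoffE//; case: (tau o) => [t||]//.
  rewrite lee_fin => t0.
  have -> : y%:E = (x%:E + (y - x)%:E)%E by rewrite -EFinD addrC subrK.
  rewrite ge0_muleDl ?lee_fin ?subr_ge0// addeAC.
  by rewrite leeD2l// lee_wpmul2l ?lee_fin ?subr_ge0// perpetuity_le.
by move=> _; rewrite add0e mule_ge0 ?lee_fin ?subr_ge0// perpetuity_ge0.
Qed.

End Perpetuity.

(** * Mean of the perpetuity *)

Section Expectation.
Variables (R : realType) (r sigma mu0 mu1 p : R).
Variable W : probability (borel (CRplus R)) R.
Hypothesis WW : wiener_measure W.
Local Notation mu := lebesgue_measure.
Local Notation flow := (flow r sigma mu0 mu1 p).
Local Notation perpetuity := (perpetuity r sigma mu0 mu1 p).

Lemma measurable_flow :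
  measurable_fun setT (fun so : measurableTypeR R * Omega R => flow so.2 so.1).
Proof.
have m1 : measurable_fun setT
    (fst : measurableTypeR R * Omega R -> measurableTypeR R).
  exact: measurable_fst.
have mdrift : measurable_fun setT
    (fun so : measurableTypeR R * Omega R => drift mu0 mu1 p so.2).
  apply: measurable_fun_if => //.
  apply: (measurableT_comp (measurable_val_le p)).
  exact: (measurableT_comp measurable_fst measurable_snd).
have mpath : measurable_fun setT
    (fun so : measurableTypeR R * Omega R => path_at so.2.2 so.1).
  pose h (so : measurableTypeR R * Omega R) := (so.1, so.2.2).
  have mh : measurable_fun setT h.
    apply: measurable_fun_pair => //.
    exact: (measurableT_comp measurable_snd measurable_snd).
  exact: (measurableT_comp (@measurable_path_at2 R) mh).
apply: measurable_funM.
  by apply: measurableT_comp => //; exact: measurable_funM.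
apply: measurable_funM => //; apply: measurableT_comp => //.
apply: measurable_funD; apply: measurable_funM => //.
exact: measurable_funB.
Qed.

(** Given the drift m, the mean of Y_s is e^(m s): the term - sigma^2 / 2 in the
    exponent offsets the exponential moment of sigma W_s. *)
Lemma expected_flow (s : R) : 0 <= p <= 1 -> 0 <= s ->
  (\int[Pr W]_o (flow o s)%:E =
   (p * expR (- (r - mu1) * s) + (1 - p) * expR (- (r - mu0) * s))%:E)%E.
Proof.
move=> p01 s0.
have ms : measurable_fun setT (fun o : Omega R => (flow o s)%:E).
  apply/measurable_EFinP.
  exact: (measurable_fun_pair2 s measurable_flow).
rewrite /Pr fubini_tonelli1//; last first.
  by move=> o; rewrite lee_fin flow_ge0.
rewrite -integral_uniform_unit_threshold ?expR_ge0//.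
apply: eq_integral => u _; rewrite /fubini_F.
transitivity (\int[W]_w ((expR ((drift mu0 mu1 p (u, point)
    - sigma ^+ 2 / 2 - r) * s))%:E * (expR (sigma * path_at w s))%:E))%E.
  apply: eq_integral => w _; rewrite /flow /X mul1r -EFinM -!expRD.
  congr (expR _)%:E; rewrite /drift /theta /BM /=; ring.
rewrite ge0_integralZl//; last first.
  apply/measurable_EFinP; apply: measurableT_comp => //.
  by apply: measurable_funM => //; exact: measurable_path_at.
rewrite wiener_expR// -EFinM -expRD /drift /theta/=.
by case: ifP => _; congr (expR _)%:E; ring.
Qed.

(** The flow cut off at time 0, so that Tonelli's theorem applies on the whole
    line of times. *)
Let F (so : measurableTypeR R * Omega R) : \bar R :=
  (flow so.2 so.1 * \1_(`[0, +oo[%classic : set (measurableTypeR R)) so.1)%:E.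

Let mF : measurable_fun setT F.
Proof.
apply/measurable_EFinP; apply: measurable_funM; first exact: measurable_flow.
have mI : measurable_fun setT
    (\1_(`[0, +oo[%classic : set (measurableTypeR R)) : measurableTypeR R -> R).
  by apply: measurable_indic; exact: measurable_itv.
exact: (measurableT_comp mI measurable_fst).
Qed.

Let F_ge0 so : (0 <= F so)%E.
Proof. by rewrite lee_fin mulr_ge0 ?flow_ge0. Qed.

Let integral_F o : (\int[mu]_s F (s, o) = perpetuity 0 o)%E.
Proof.
rewrite /perpetuity [RHS]integral_mkcond.
by apply: eq_integral => s _; rewrite epatch_indic /F EFinM.
Qed.

Lemma measurable_perpetuity : measurable_fun setT (perpetuity 0).
Proof.
rewrite (_ : perpetuity 0 = fubini_G mu F).
  exact: measurable_fun_fubini_tonelli_G.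
by apply/funext => o; rewrite -integral_F.
Qed.

Lemma expected_perpetuity : 0 <= p <= 1 -> mu0 < r -> mu1 < r ->
  (\int[Pr W]_o perpetuity 0 o =
   ((1 - p) / (r - mu0) + p / (r - mu1))%:E)%E.
Proof.
move=> p01 r0 r1.
pose D : set (measurableTypeR R) := `[0, +oo[%classic.
under eq_integral do rewrite -integral_F.
rewrite -(fubini_tonelli F mF F_ge0).
transitivity (\int[mu]_(s in D) ((p * expR (- (r - mu1) * s))%:E +
    ((1 - p) * expR (- (r - mu0) * s))%:E))%E.
  rewrite [RHS]integral_mkcond; apply: eq_integral => s _.
  rewrite patchE; case: ifPn => [|nD].
    rewrite inE /D/= in_itv/= andbT => s0; rewrite -EFinD -expected_flow//.
    apply: eq_integral => o _; rewrite /F indicE mem_set ?mulr1//.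
    by rewrite /D /= in_itv/= s0.
  by apply: integral0_eq => o _; rewrite /F indicE (negbTE nD) mulr0.
have mexp (k : R) : measurable_fun D (fun s => (expR (- k * s))%:E).
  apply/measurable_EFinP; apply: measurable_funTS.
  apply: continuous_measurable_fun; apply: continuous_expR_comp.
  exact: mulrl_continuous.
have [p0 p1] := andP p01.
have linear (c k : R) : 0 <= c -> 0 < k ->
    (\int[mu]_(s in D) (c * expR (- k * s))%:E = (c / k)%:E)%E.
  move=> c0 k0; under eq_integral do rewrite EFinM.
  rewrite ge0_integralZl; [|exact: measurable_itv|exact: mexp
    |by move=> s _; rewrite lee_fin expR_ge0|by rewrite lee_fin].
  by rewrite integral_expRN// -EFinM.
have pos (c k : R) : 0 <= c ->
    forall s, D s -> (0 <= (c * expR (- k * s))%:E)%E.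
  by move=> c0 s _; rewrite lee_fin mulr_ge0 ?expR_ge0.
have mlin (c k : R) : measurable_fun D (fun s => (c * expR (- k * s))%:E).
  have mc : measurable_fun D (cst c%:E) by [].
  exact: (emeasurable_funM mc (mexp k)).
rewrite ge0_integralD; [|exact: measurable_itv|by apply: pos|exact: mlin
  |by apply: pos; rewrite subr_ge0|exact: mlin].
by rewrite !linear ?subr_ge0 ?subr_gt0// -EFinD addrC.
Qed.

End Expectation.

(** * Comparison of mean payoffs *)

Section Optimality.
Variables (R : realType) (W : probability (borel (CRplus R)) R).
Variables (I r sigma mu0 mu1 p : R).

(** X^(y,p) is a constant multiple of X^(x,p), so its generating events are
    among those of X^(x,p). *)
Lemma filtration_scale x y t (A : set (Omega R)) : 0 < x ->
  filtration W sigma mu0 mu1 y p t A -> filtration W sigma mu0 mu1 x p t A.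
Proof.
move=> x0; apply: smallest_sub; first exact: smallest_sigma_algebra.
rewrite /filtration => B [|nB]; last first.
  by apply: (@sub_sigma_algebra _ setT); right.
move=> [s [st [C mC ->]]]; apply: (@sub_sigma_algebra _ setT); left.
exists s; split => //.
exists ( *%R (y / x) @^-1` C).
  rewrite -[X in measurable X]setTI.
  have mM : measurable_fun setT (fun z : measurableTypeR R => y / x * z).
    exact: measurable_funM.
  exact: mM.
suff -> : X sigma mu0 mu1 y p s = *%R (y / x) \o X sigma mu0 mu1 x p s.
  by rewrite comp_preimage.
apply: funext => o /=.
by rewrite (X_scale _ _ _ _ x) (X_scale _ _ _ _ y) mulrA divfK// gt_eqF.
Qed.

Lemma stopping_time_scale x y tau : 0 < x ->
  stopping_time W sigma mu0 mu1 y p tau ->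
  stopping_time W sigma mu0 mu1 x p tau.
Proof.
move=> x0 [tau0 mtau]; split => // t t0.
by apply: filtration_scale => //; exact: mtau.
Qed.

Lemma stopping_time0 x : stopping_time W sigma mu0 mu1 x p (cst 0%E).
Proof.
split => // t t0; rewrite (_ : [set _ | _] = setT).
  have [s0 sC _] := @smallest_sigma_algebra _ setT
    ([set A | exists s, 0 <= s <= t /\
       exists2 B, measurable B & A = X sigma mu0 mu1 x p s @^-1` B]
     `|` (Pr W).-negligible).
  by have := sC _ s0; rewrite setD0.
by apply/seteqP; split => o //= _; rewrite lee_fin.
Qed.

Lemma payoff_neg_lty x tau : 0 < r -> 0 <= I -> 0 <= x ->
  (forall o, 0 <= tau o)%E ->
  (\int[Pr W]_o (payoff I r sigma mu0 mu1 x p tau)^\- o < +oo)%E.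
Proof.
move=> r0 I0 x0 tau0.
apply: (@le_lt_trans _ _ (\int[Pr W]_o (cst I%:E) o)%E).
  apply: le_integral_nonneg => o; first exact: funeneg_ge0.
  rewrite funenegE ge_max lee_fin I0 andbT leeNl -EFinN.
  exact: payoff_ge.
by rewrite integral_cst//= probability_setT mule1 ltry.
Qed.

Hypotheses (WW : wiener_measure W) (I_gt0 : 0 < I) (r_gt0 : 0 < r).
Hypotheses (mu0r : mu0 < r) (mu1r : mu1 < r) (p01 : 0 <= p <= 1).

Lemma expected_payoff0 x : 0 <= x ->
  (\int[Pr W]_o payoff I r sigma mu0 mu1 x p (cst 0%E) o =
   (g I r mu0 mu1 x p)%:E)%E.
Proof.
move=> x0; have mperp := @measurable_perpetuity R r sigma mu0 mu1 p.
have perp0 := @perpetuity_ge0 R r sigma mu0 mu1 p 0.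
have int_perp : (\int[Pr W]_o (x%:E * perpetuity r sigma mu0 mu1 p 0 o) =
    (x * ((1 - p) / (r - mu0) + p / (r - mu1)))%:E)%E.
  rewrite ge0_integralZl; [|exact: measurableT|exact: mperp
    |by move=> o _; exact: perp0|by rewrite lee_fin].
  by rewrite expected_perpetuity.
transitivity (\int[Pr W]_o
    (x%:E * perpetuity r sigma mu0 mu1 p 0 o - cst I%:E o))%E.
  apply: eq_integral => o _; rewrite payoffE//=.
  by rewrite mulr0 expR0 mul1r.
rewrite integralB; [|exact: measurableT| |exact: finite_measure_integrable_cst].
  by rewrite int_perp integral_cst//= probability_setT mule1.
apply/integrableP; split; first exact: emeasurable_funM.
rewrite (eq_integral (fun o => x%:E * perpetuity r sigma mu0 mu1 p 0 o)%E).
  by rewrite int_perp ltry.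
by move=> o _; rewrite gee0_abs// mule_ge0 ?lee_fin.
Qed.

Lemma expected_payoff_le x y tau : 0 < x -> x <= y ->
  (forall o, 0 <= tau o)%E ->
  (\int[Pr W]_o payoff I r sigma mu0 mu1 y p tau o <=
   \int[Pr W]_o payoff I r sigma mu0 mu1 x p tau o +
   (g I r mu0 mu1 y p - g I r mu0 mu1 x p)%:E)%E.
Proof.
move=> x0 xy tau0.
have y0 : 0 <= y by rewrite (le_trans (ltW x0)).
have mperp := @measurable_perpetuity R r sigma mu0 mu1 p.
have -> : (g I r mu0 mu1 y p - g I r mu0 mu1 x p)%:E =
    (\int[Pr W]_o ((y - x)%:E * perpetuity r sigma mu0 mu1 p 0 o))%E.
  rewrite ge0_integralZl; last 4 first.
  - exact: measurableT.
  - exact: mperp.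
  - by move=> o _; exact: perpetuity_ge0.
  - by rewrite lee_fin subr_ge0.
  rewrite expected_perpetuity// -EFinM /g; congr EFin; ring.
apply: le_integral_add.
- by apply: emeasurable_funM.
- by move=> o; rewrite mule_ge0 ?lee_fin ?subr_ge0// perpetuity_ge0.
- by move=> o; apply: payoff_le_add => //; exact: ltW.
- by apply: payoff_neg_lty => //; exact: ltW.
- by apply: payoff_neg_lty => //; exact: ltW.
Qed.

End Optimality.

Theorem lemma3p3 (R : realType) (I r sigma mu0 mu1 : R)
    (I_gt0 : 0 < I) (sigma_gt0 : 0 < sigma) (r_gt0 : 0 < r)
    (mu01 : mu0 < mu1) (r_gt : Num.max mu0 mu1 < r)
    (W : probability (borel (CRplus R)) R) (WW : wiener_measure W)
    (x p xhat : R) (x_gt0 : 0 < x) (p01 : 0 <= p <= 1) (x_xhat : x < xhat) :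
  stopping_set W I r sigma mu0 mu1 (x, p) ->
  stopping_set W I r sigma mu0 mu1 (xhat, p).
Proof.
move: r_gt; rewrite gt_max => /andP[mu0r mu1r] [/= _ _ valx].
have xhat_gt0 : 0 < xhat by exact: lt_trans x_xhat.
split => //=; apply/le_anti/andP; split.
  apply: ge_ereal_sup => _ [tau ttau <-].
  have [tau0 _] := ttau.
  have le_tau := expected_payoff_le sigma WW I_gt0 r_gt0 mu0r mu1r p01 x_gt0
    (ltW x_xhat) tau0.
  apply: le_trans le_tau _.
  rewrite (_ : (g I r mu0 mu1 xhat p)%:E =
    (g I r mu0 mu1 x p)%:E + (g I r mu0 mu1 xhat p - g I r mu0 mu1 x p)%:E)%E.
    rewrite leeD2r// -valx; apply: ereal_sup_ubound; exists tau => //.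
    exact: stopping_time_scale ttau.
  by rewrite -EFinD addrC subrK.
have <- := expected_payoff0 I sigma WW mu0r mu1r p01 (ltW xhat_gt0).
apply: ereal_sup_ubound; exists (cst 0%E) => //.
exact: stopping_time0.
Qed.
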